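(* Let $m\ge 3$ and let $1=c_1\ge c_2\ge\cdots\ge c_{m-1}\ge 0$ be given real numbers. The moment matrix $M_0=\frac{1}{m!}\sum_{a\in A}x(a)x(a)^T$ of the uniform design measure on the set $A$ of all $m!$ permutations of $1,\ldots,m$ is $$M_0=\mathrm{diag}(1,\;b_0I+b_1V)$$ (block diagonal), and it has eigenvalues $1$, $b_0+(m-2)b_1$ and $b_0-2b_1$, with multiplicities $1$, $m-1$ and $(m-1)(m-2)/2$, respectively. Here $x(a)$, $b_0$, $b_1$, $I$ and $V$ are as defined in the context.
   Context: Treatments: $A$ is the set of all orderings $a=a_1\ldots a_m$ of $1,\ldots,m$. $S$ is the set of all pairs $ij$ with $1\le i<j\le m$, listed in the order $12,13,\ldots,1m,23,\ldots,(m-1)m$. For $a\in A$ and $ij\in S$, $h(ij,a)=|k-l|$, where $a_k=i$, $a_l=j$. Define $z_{ij}(a)=c_{h(ij,a)}$ if $i$ precedes $j$ in $a$, and $z_{ij}(a)=-c_{h(ij,a)}$ if $j$ precedes $i$ in $a$. Let $q=m(m-1)/2$, let $z(a)=(z_{ij}(a))_{ij\in S}$ be the corresponding $q\times1$ column vector, and $x(a)=[1,z(a)^T]^T$. $I$ is the identity matrix of order $q$. $V$ is the $q\times q$ matrix with rows and columns indexed by $S$ whose $(ij,kl)$th element, for $ij,kl\in S$, is $V(ij,kl)=1$ if ($i=k$ and $j\ne l$) or ($i\ne k$ and $j=l$); $V(ij,kl)=-1$ if $i=l$ or $j=k$; and $V(ij,kl)=0$ otherwise. The constants are $$b_0=\frac{2\sum_{h=1}^{m-1}(m-h)c_h^2}{m(m-1)},\qquad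 b_1=\frac{2\sum_{h}\{m-h(1)-h(2)\}\,c_{h(1)}\{2c_{h(1)+h(2)}-c_{h(2)}\}}{m(m-1)(m-2)},$$ where in $b_1$ the sum is over all ordered pairs of positive integers $h(1),h(2)$ with $h(1)+h(2)\le m-1$. If some of the listed eigenvalues coincide numerically, their multiplicities are understood to be added. *)

(* Defs.v *)
From HB Require Import structures.
From mathcomp Require Import all_boot all_order all_fingroup all_algebra.
Set Implicit Arguments.
Unset Strict Implicit.
Unset Printing Implicit Defensive.
Import Order.TTheory GRing.Theory Num.Theory.
Local Open Scope ring_scope.

(** Treatments [1, ..., m] are shifted to ['I_m] (that is [0, ..., m-1]), which
    changes neither the order of the treatments nor the distances between
    positions.  An ordering [a_1 ... a_m] is the permutation [a : 'S_m] sending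
    a position to the treatment standing there. *)

Definition pairs (m : nat) : seq ('I_m * 'I_m) :=
  [seq (i, j) | i : 'I_m <- enum 'I_m,
                j : 'I_m <- [seq j : 'I_m <- enum 'I_m | (i < j)%N]].

Definition q (m : nat) : nat := (m * m.-1)./2.

Lemma size_pairs (m : nat) : size (pairs m) == q m.
Proof.
rewrite size_allpairs_dep sumnE big_map big_enum /q -bin2 -bin2_sum /=.
rewrite big_mkord (reindex_inj rev_ord_inj) /=; apply/eqP/eq_bigr => i _.
rewrite size_filter -(count_map val (ltn (rev_ord i))) val_enum_ord.
rewrite -size_filter -(size_iota (rev_ord i).+1 i).
congr size; have lim := ltn_ord i.
rewrite /= (_ : iota 0 m = iota 0 (m - i.+1).+1 ++ iota (m - i.+1).+1 i); last first.
  by rewrite -iotaD subnSK // subnK // ltnW.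
rewrite filter_cat (eq_in_filter (a2 := pred0)) ?filter_pred0; last first.
  by move=> k; rewrite mem_iota /= add0n ltnS leqNgt => /negbTE.
by apply/all_filterP/allP => k; rewrite mem_iota => /andP[].
Qed.

Definition Spairs (m : nat) : (q m).-tuple ('I_m * 'I_m) := Tuple (size_pairs m).

Definition pos (m : nat) (a : 'S_m) (i : 'I_m) : 'I_m := (a^-1)%g i.

Definition hdist (m : nat) (ij : 'I_m * 'I_m) (a : 'S_m) : nat :=
  `|pos a ij.1 - pos a ij.2|%N.

Definition z (R : realFieldType) (m : nat) (c : nat -> R) (a : 'S_m) :
    'cV[R]_(q m) :=
  \col_r (let ij := tnth (Spairs m) r in
          if (pos a ij.1 < pos a ij.2)%N then c (hdist ij a)
          else - c (hdist ij a)).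

Definition x (R : realFieldType) (m : nat) (c : nat -> R) (a : 'S_m) :
    'cV[R]_(1 + q m) :=
  col_mx 1%:M (z c a).

Definition M0 (R : realFieldType) (m : nat) (c : nat -> R) : 'M[R]_(1 + q m) :=
  (m`!%:R)^-1 *: \sum_(a : 'S_m) x c a *m (x c a)^T.

Definition V (R : realFieldType) (m : nat) : 'M[R]_(q m) :=
  \matrix_(r, s)
    (let: (i, j) := tnth (Spairs m) r in
     let: (k, l) := tnth (Spairs m) s in
     if ((i == k) && (j != l)) || ((i != k) && (j == l)) then 1
     else if (i == l) || (j == k) then -1
     else 0).

Definition b0 (R : realFieldType) (m : nat) (c : nat -> R) : R :=
  2 * (\sum_(1 <= h < m) (m - h)%:R * c h ^+ 2) / (m%:R * (m%:R - 1)).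

Definition b1 (R : realFieldType) (m : nat) (c : nat -> R) : R :=
  2 * (\sum_(1 <= h1 < m) \sum_(1 <= h2 < m | (h1 + h2 <= m - 1)%N)
         (m - h1 - h2)%:R * c h1 * (2 * c (h1 + h2)%N - c h2))
  / (m%:R * (m%:R - 1) * (m%:R - 2)).

(** [s] lists the eigenvalues of [A] with their multiplicities, both algebraic
    and geometric; an eigenvalue listed several times has the sum of the listed
    multiplicities. *)
Definition has_spectrum (R : fieldType) (n : nat) (A : 'M[R]_n)
    (s : seq (R * nat)) : Prop :=
  char_poly A = \prod_(p <- s) ('X - p.1%:P) ^+ p.2 /\
  forall lambda : R,
    \rank (eigenspace A lambda) = (\sum_(p <- s | p.1 == lambda) p.2)%N.

(* Main.v *)
Require Import Defs.
From mathcomp Require Import all_boot all_order all_fingroup all_algebra.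
From mathcomp Require Import all_solvable ring lra zify.
Import Order.TTheory GRing.Theory Num.Theory.
Local Open Scope ring_scope.
Set Implicit Arguments.
Unset Strict Implicit.
Unset Printing Implicit Defensive.

(** Extend [z_ij] to all ordered pairs of treatments by [z_ji = - z_ij]: it is
    then [skew c] evaluated at the positions of [i] and [j].  Under the uniform
    measure the moments of these variables are invariant under relabelling the
    treatments, and exchanging [i] and [j] changes the sign of [z_ij].  Hence
    the means vanish ([moment1]), and so do the mixed moments of disjoint pairs
    ([moment2_disjoint]).  By transitivity of the symmetric group there remain
    only two constants, the moment of [z_ij ^ 2] and that of [z_ij z_ik], each
    the average of a function over all pairs or triples of distinct positions
    ([sum_perm_pair], [sum_perm_triple]).  Sorting the positions and grouping
    them by their successive gaps identifies the two averages as [b0] and [b1]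
    ([moment2_same], [moment2_adjacent]).

    All of this is summed up by the matrix [B = incidence R m] whose row [ij] is
    [e_i - e_j], the signed incidence matrix of the complete graph.  The
    covariance block of [M0] is [(b0 - 2 b1) I + b1 B B^T] ([M0_block]), and
    [B B^T = 2 I + V] ([incidence_mul_tr]) turns this into [b0 I + b1 V].

    For the spectrum, [B^T B = m I - J] where [J] is the all-ones matrix, and
    [B J = 0], so that [P = m^-1 B B^T] is idempotent; in characteristic zero
    its rank is its trace [m - 1].  Therefore the block, which is
    [(b0 - 2 b1) I + m b1 P], is similar to a diagonal matrix with entries
    [b0 + (m - 2) b1] on the range of [P] and [b0 - 2 b1] on its kernel
    ([has_spectrum_idem]). *)

(** * Spectra of block-diagonal and idempotent matrices *)

Lemma has_spectrum_scalar (F : fieldType) n (a : F) :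
  has_spectrum (a%:M : 'M_n) [:: (a, n)].
Proof.
split=> [|lambda].
  rewrite char_poly_trig ?scalar_mx_is_trig // big_seq1 /=.
  rewrite (eq_bigr (fun=> 'X - a%:P)) => [|i _]; last by rewrite mxE eqxx.
  by rewrite prodr_const card_ord.
rewrite mxrank_ker -raddfB /= big_mkcond big_seq1 /= -subr_eq0.
case: eqP => [->|/eqP nz]; first by rewrite raddf0 mxrank0 subn0.
by rewrite -scalemx1 mxrank_scale_nz // mxrank1 subnn.
Qed.

Lemma has_spectrum_block (F : fieldType) n1 n2 (A : 'M[F]_n1) (B : 'M_n2) s t :
  has_spectrum A s -> has_spectrum B t ->
  has_spectrum (block_mx A 0 0 B) (s ++ t).
Proof.
move=> [chA rkA] [chB rkB]; split=> [|lambda].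
  by rewrite /char_poly char_block_diag_mx det_ublock -!/(char_poly _) chA chB
             big_cat.
rewrite big_cat /= -rkA -rkB !mxrank_ker (scalar_mx_block n1 n2) opp_block_mx.
rewrite add_block_mx !oppr0 !addr0 rank_diag_block_mx.
have := rank_leq_row (A - lambda%:M); have := rank_leq_row (B - lambda%:M).
move: (\rank _) (\rank _) => rB rA; lia.
Qed.

Lemma has_spectrum_similar (F : fieldType) n (Q A D : 'M[F]_n) s :
  Q \in unitmx -> Q *m A = D *m Q -> has_spectrum D s -> has_spectrum A s.
Proof.
move=> Qu QA [chD rkD]; split=> [|lambda].
  have Qnz : \det (map_mx polyC Q) != 0.
    by rewrite det_map_mx polyC_eq0 -unitfE -unitmxE.
  apply: (mulfI Qnz); rewrite -chD -det_mulmx mulrC -det_mulmx.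
  rewrite /char_poly_mx mulmxBl mulmxBr -!map_mxM QA.
  by rewrite scalar_mxC.
rewrite -rkD !mxrank_ker; congr (_ - _)%N.
rewrite -(mxrankMfree (D - _) (B := Q)) ?row_free_unit //.
rewrite mulmxBl -QA -scalar_mxC -mulmxBr.
by apply/eqP; rewrite eqmxMfull // row_full_unit.
Qed.

(** In the full-rank factorization [P = C R] of an idempotent matrix,
    [C R C R = C R] cancels to [R C = 1], and [\tr (C R) = \tr (R C)]. *)
Lemma mxtrace_idem (F : fieldType) n (P : 'M[F]_n) :
  P *m P = P -> \tr P = (\rank P)%:R.
Proof.
move=> idP; have eP := mulmx_base P.
suff CR1 : row_base P *m col_base P = 1%:M.
  by rewrite -[in LHS]eP mxtrace_mulC CR1 mxtrace1.
apply: (row_free_inj (row_base_free P)); rewrite mul1mx.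
apply: (row_full_inj (col_base_full P)).
by rewrite 2!mulmxA eP -mulmxA eP.
Qed.

(** Write [P = L D U] by Gaussian elimination, with [D = pid_mx (\rank P)].
    Conjugation by [U] turns [P] into [E = U L D], an idempotent such that
    [D E = D] and [E D = E].  Two idempotents related in this way are conjugate
    by [1 - (E - D)], which is invertible because [(E - D)^2 = 0]. *)
Lemma idem_similar_pid (F : fieldType) n (P : 'M[F]_n) :
  P *m P = P ->
  exists2 Q, Q \in unitmx & Q *m P = pid_mx (\rank P) *m Q.
Proof.
move=> idP; set D := pid_mx _; set L := col_ebase P; set U := row_ebase P.
have eP : L *m D *m U = P := mulmx_ebase P.
have DD : D *m D = D by rewrite pid_mx_id ?rank_leq_row.
pose E := U *m L *m D.
have DE : D *m E = D.
  apply: (can_inj (mulKmx (col_ebase_unit P))).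
  apply: (can_inj (mulmxK (row_ebase_unit P))).
  by rewrite -/L -/U eP -[RHS]idP -[in RHS]eP /E !mulmxA.
have ED : E *m D = E by rewrite /E -mulmxA DD.
have EE : E *m E = E by rewrite -{1}ED -mulmxA DE ED.
exists ((1%:M - (E - D)) *m U); last first.
  rewrite -[in LHS]eP !mulmxA -(mulmxA _ U) -(mulmxA _ _ D) -/E; congr (_ *m U).
  rewrite !(mulmxBl, mulmxBr) mul1mx mulmx1 EE DE DD.
  by rewrite opprB addrC subrK subrr subr0.
rewrite unitmx_mul row_ebase_unit andbT.
have N2 : (E - D) *m (E - D) = 0.
  by rewrite mulmxBl !mulmxBr EE ED DE DD !subrr.
suff /mulmx1_unit [] : (1%:M - (E - D)) *m (1%:M + (E - D)) = 1%:M by [].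
by rewrite mulmxBl !mul1mx mulmxDr N2 mulmx1 addr0 addrK.
Qed.

(** The dimension is split as [r + k] so that a diagonal form of [P] is a block
    matrix: identity on the range, zero on the kernel. *)
Lemma has_spectrum_idem (F : fieldType) n r k (P : 'M[F]_n) (a b : F) :
  P *m P = P -> \rank P = r -> n = (r + k)%N ->
  has_spectrum (a%:M + b *: P) [:: (a + b, r); (a, k)].
Proof.
move=> idP rkP En; subst n.
have [Q Qu QP] := idem_similar_pid idP.
apply: (has_spectrum_similar (D := a%:M + b *: pid_mx r) Qu).
  by rewrite mulmxDr mulmxDl -scalemxAr -scalemxAl QP rkP scalar_mxC.
rewrite pid_mx_block (scalar_mx_block r k) scale_block_mx add_block_mx.
rewrite !scaler0 !addr0 scalemx1 -raddfD.
exact: has_spectrum_block (has_spectrum_scalar _ _) (has_spectrum_scalar _ _).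
Qed.

(** * The signed incidence matrix of the complete graph *)

Lemma tnth_Spairs_lt m r : ((tnth (Spairs m) r).1 < (tnth (Spairs m) r).2)%N.
Proof.
have /allpairsPdep [i [j [_]]] := mem_tnth r (Spairs m).
by rewrite mem_filter => /andP[ltij _] ->.
Qed.

Lemma tnth_Spairs_inj m : injective (tnth (Spairs m)).
Proof.
apply/tuple_uniqP/allpairs_uniq_dep => [|i _|].
- exact: enum_uniq.
- by rewrite filter_uniq ?enum_uniq.
by move=> [i j] [k l] _ _ /= [-> ->].
Qed.

Lemma sum_Spairs (R : nmodType) m (F : 'I_m * 'I_m -> R) :
  \sum_r F (tnth (Spairs m) r) = \sum_(i < m) \sum_(j < m | (i < j)%N) F (i, j).
Proof.
rewrite -(big_tuple _ _ (Spairs m) xpredT F) big_allpairs_dep big_enum /=.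
by apply: eq_bigr => i _; rewrite big_filter big_enum_cond.
Qed.

Lemma sum_offdiag_sym (R : nmodType) m (F : 'I_m -> 'I_m -> R) :
  (forall i j, F i j = F j i) -> (forall i, F i i = 0) ->
  \sum_i \sum_j F i j = (\sum_(i < m) \sum_(j < m | (i < j)%N) F i j) *+ 2.
Proof.
move=> symF F0; rewrite mulr2n.
have -> : \sum_i \sum_j F i j =
    \sum_(i < m) \sum_(j < m | (i < j)%N) F i j +
    \sum_(i < m) \sum_(j < m | (j < i)%N) F i j.
  rewrite -big_split /=; apply: eq_bigr => i _.
  rewrite (bigID (fun j : 'I_m => (i < j)%N)) /=; congr (_ + _).
  rewrite (bigD1 i) ?ltnn //= F0 add0r; apply: eq_bigl => j.
  by rewrite -leqNgt ltn_neqAle andbC.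
congr (_ + _); rewrite (exchange_big_dep xpredT) //=.
by apply: eq_bigr => i _; apply: eq_bigr => j _; apply: symF.
Qed.

Definition incidence (R : pzRingType) m : 'M[R]_(q m, m) :=
  \matrix_(r, k)
    (((tnth (Spairs m) r).1 == k)%:R - ((tnth (Spairs m) r).2 == k)%:R).

Lemma sum_delta (R : pzRingType) (T : finType) (i : T) (f : T -> R) :
  \sum_k (i == k)%:R * f k = f i.
Proof.
rewrite (bigD1 i) //= eqxx mul1r big1 ?addr0 // => k nk.
by rewrite eq_sym (negPf nk) mul0r.
Qed.

Lemma incidence_gram (R : pzRingType) m r s :
  (incidence R m *m (incidence R m)^T) r s =
  let: (i, j) := tnth (Spairs m) r in let: (k, l) := tnth (Spairs m) s in
  (i == k)%:R - (i == l)%:R - (j == k)%:R + (j == l)%:R.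
Proof.
rewrite mxE; case Er: (tnth _ r) => [i j]; case Es: (tnth _ s) => [k l].
under eq_bigr => t _ do rewrite !mxE Er Es mulrBl /=.
rewrite sumrB !sum_delta (eq_sym k) (eq_sym l) (eq_sym k) (eq_sym l).
by rewrite opprB addrA addrAC -!addrA [- _ + _]addrC.
Qed.

(** Two edges sharing exactly one vertex have incidence product [1] if they both
    leave it or both enter it, and [-1] otherwise: this is the sign rule defining
    [V]. *)
Lemma incidence_mul_tr (R : realFieldType) m :
  incidence R m *m (incidence R m)^T = 2%:M + V R m.
Proof.
apply/matrixP => r s; rewrite incidence_gram !mxE.
rewrite -(inj_eq (@tnth_Spairs_inj m)).
have := tnth_Spairs_lt r; have := tnth_Spairs_lt s.
case: (tnth _ r) => [i j]; case: (tnth _ s) => [k l] /=; rewrite xpair_eqE.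
rewrite -!(inj_eq val_inj) /=.
move: {i j k l}(i : nat) (j : nat) (k : nat) (l : nat) => i j k l ltkl ltij.
have [eik|nik] := eqVneq i k; have [ejl|njl] := eqVneq j l => /=.
- have -> : (i == l) = false by lia.
  have -> : (j == k) = false by lia.
  by rewrite /= mulr1n; ring.
- have -> : (i == l) = false by lia.
  have -> : (j == k) = false by lia.
  by rewrite /= mulr0n; ring.
- have -> : (i == l) = false by lia.
  have -> : (j == k) = false by lia.
  by rewrite /= mulr0n; ring.
- have [eil|nil] := eqVneq i l; have [ejk|njk] := eqVneq j k => /=.
  + by lia.
  + by rewrite /= mulr0n; ring.
  + by rewrite /= mulr0n; ring.
  + by rewrite /= mulr0n; ring.
Qed.

Lemma incidence_tr_mul (R : numFieldType) m :
  (incidence R m)^T *m incidence R m = m%:R%:M - const_mx 1.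
Proof.
apply/matrixP => k l; rewrite !mxE.
pose F (i j : 'I_m) : R :=
  ((k == i)%:R - (k == j)%:R) * ((l == i)%:R - (l == j)%:R).
transitivity (\sum_r F (tnth (Spairs m) r).1 (tnth (Spairs m) r).2).
  by apply: eq_bigr => r _; rewrite !mxE /F ![_ == k]eq_sym ![_ == l]eq_sym.
rewrite (sum_Spairs (fun p => F p.1 p.2)) /=.
(* The symmetric sum over all ordered pairs is twice the sum over [i < j]. *)
apply: (mulIf (x := 2)); first by rewrite pnatr_eq0.
rewrite mulr_natr -sum_offdiag_sym; last 2 first.
- by move=> i j; rewrite /F; ring.
- by move=> i; rewrite /F; ring.
have sumF i : \sum_j F i j =
    m%:R * ((k == i)%:R * (l == i)%:R) - (k == i)%:R * 1 - (l == i)%:R * 1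
    + (l == k)%:R.
  transitivity (\sum_j ((k == i)%:R * (l == i)%:R - (l == j)%:R * (k == i)%:R
                        - (k == j)%:R * (l == i)%:R
                        + (k == j)%:R * (l == j)%:R : R)).
    by apply: eq_bigr => j _; rewrite /F; ring.
  rewrite !(big_split, sumrN) /= !sum_delta sumr_const card_ord -mulr_natl.
  by ring.
under eq_bigr => i _ do rewrite sumF.
rewrite !(big_split, sumrN) /= -mulr_sumr !sum_delta sumr_const card_ord.
by rewrite eq_sym -mulr_natl; case: eqP => _; rewrite ?mulr1n ?mulr0n; ring.
Qed.

Lemma sum_row_incidence (R : pzRingType) m n :
  incidence R m *m const_mx 1 = 0 :> 'M_(q m, n).
Proof.
apply/matrixP => r s; rewrite !mxE.
under eq_bigr => k _ do rewrite !mxE mulrBl.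
by rewrite sumrB !sum_delta subrr.
Qed.

(** [B^T B] acts as multiplication by [m] on vectors of zero sum, and the rows
    of [B] have zero sum: [B B^T] is [m] times the orthogonal projection onto
    the column space of [B]. *)
Lemma incidence_proj_idem (R : numFieldType) m (B := incidence R m) :
  (0 < m)%N ->
  (m%:R^-1 *: (B *m B^T)) *m (m%:R^-1 *: (B *m B^T)) = m%:R^-1 *: (B *m B^T).
Proof.
move=> m_gt0; rewrite -scalemxAl -scalemxAr; congr (_ *: _).
rewrite mulmxA -(mulmxA B) incidence_tr_mul mulmxBr sum_row_incidence subr0.
by rewrite mul_mx_scalar -scalemxAl scalerA mulVf ?scale1r // pnatr_eq0 -lt0n.
Qed.

Lemma rank_incidence_proj (R : numFieldType) m (B := incidence R m) :
  (0 < m)%N -> \rank (m%:R^-1 *: (B *m B^T)) = m.-1.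
Proof.
move=> m_gt0; apply/eqP; rewrite -(eqr_nat R).
rewrite -mxtrace_idem ?incidence_proj_idem //.
rewrite mxtraceZ mxtrace_mulC incidence_tr_mul raddfB /= mxtrace_scalar.
have -> : \tr (const_mx 1 : 'M[R]_m) = m%:R.
  rewrite /mxtrace (eq_bigr (fun=> 1)) => [|i _]; last by rewrite mxE.
  by rewrite sumr_const card_ord.
have m0 : m%:R != 0 :> R by rewrite pnatr_eq0 -lt0n.
by rewrite -(mulr_natr m%:R) -[X in _ - X]mulr1 -mulrBr mulKf // -subn1 natrB.
Qed.

(** * Averages over permutations *)

(** A random permutation sends any tuple of distinct points to a uniformly
    distributed one: by transitivity of the symmetric group on such tuples the
    left-hand sum does not depend on [t], and it can be averaged over [t]. *)
Lemma sum_perm_uniq_tuple (R : nmodType) (T : finType) n (F : n.-tuple T -> R)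
    (t : n.-tuple T) :
  uniq t ->
  (\sum_(a : {perm T}) F (map_tuple a t)) *+ (#|T| ^_ n) =
  (\sum_(u : n.-tuple T | uniq u) F u) *+ #|T|`!.
Proof.
move=> t_uniq.
have S_const (u : n.-tuple T) : uniq u ->
    \sum_(a : {perm T}) F (map_tuple a u) =
    \sum_(a : {perm T}) F (map_tuple a t).
  move=> u_uniq.
  have n_le : (n <= #|T|)%N by rewrite -(card_uniq_tuple t_uniq) max_card.
  have dt (v : n.-tuple T) : uniq v -> v \in n.-dtuple([set: T]).
    by rewrite inE => ->; apply/subsetP => ?; rewrite inE.
  have trT := ntransitive_weak n_le (Sym_trans T).
  have [s _ ->] := atransP2 trT (dt _ t_uniq) (dt _ u_uniq).
  rewrite [RHS](reindex_inj (mulgI s)); apply: eq_bigr => a _.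
  by congr F; apply: eq_from_tnth => i; rewrite !tnth_map permM.
have -> : (#|T| ^_ n = #|[pred u : n.-tuple T | uniq u]|)%N.
  rewrite -[LHS](card_uniq_tuples n (T := T) predT) -cardsE.
  apply: eq_card => u.
  by rewrite !inE all_predT.
rewrite -sumr_const -(eq_bigr _ (fun u => S_const u)) exchange_big /=.
rewrite (eq_bigr (fun=> \sum_(u : n.-tuple T | uniq u) F u)) => [|a _].
  by rewrite sumr_const -card_Sym cardsT.
rewrite [RHS](reindex_onto (map_tuple a) (map_tuple (a^-1)%g)) => [|u _].
  apply: eq_bigl => u; rewrite map_inj_uniq; last exact: perm_inj.
  rewrite (_ : map_tuple _ _ = u) ?eqxx ?andbT //.
  by apply: eq_from_tnth => i; rewrite !tnth_map permK.
by apply: eq_from_tnth => i; rewrite !tnth_map permKV.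
Qed.

Lemma sum_perm_pair (R : pzRingType) m (F : 'I_m -> 'I_m -> R) (i j : 'I_m) :
  i != j ->
  (m * m.-1)%:R * \sum_(a : 'S_m) F (a i) (a j) =
  m`!%:R * \sum_p \sum_(q | q != p) F p q.
Proof.
rewrite !mulr_natl => nij; pose t : 2.-tuple 'I_m := [tuple i; j].
have t_uniq : uniq t by rewrite /= inE nij.
have := sum_perm_uniq_tuple (fun u => F (tnth u ord0) (tnth u ord_max)) t_uniq.
rewrite card_ord !ffactnS ffactn0 muln1 => E.
rewrite [in RHS](_ : \sum_p _ =
   \sum_(u : 2.-tuple 'I_m | uniq u) F (tnth u ord0) (tnth u ord_max)) -?E //.
rewrite pair_big_dep /=.
rewrite (reindex (fun u : 2.-tuple 'I_m => (tnth u ord0, tnth u ord_max))) /=.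
  by apply: eq_bigl => -[[|p [|q []]] //= pu]; rewrite !inE andbT eq_sym.
exists (fun p => [tuple p.1; p.2]) => [[[|p [|q []]] //= pu] _|[p q] _] //.
exact: val_inj.
Qed.

Lemma sum_perm_triple (R : pzRingType) m (F : 'I_m -> 'I_m -> 'I_m -> R)
    (i j k : 'I_m) :
  i != j -> i != k -> j != k ->
  (m * (m.-1 * m.-2))%:R * \sum_(a : 'S_m) F (a i) (a j) (a k) =
  m`!%:R * \sum_p \sum_(q | q != p) \sum_(r | (r != p) && (r != q)) F p q r.
Proof.
rewrite !mulr_natl => nij nik njk; pose t : 3.-tuple 'I_m := [tuple i; j; k].
have t_uniq : uniq t by rewrite /= !inE negb_or nij nik njk.
pose o1 : 'I_3 := Ordinal (isT : 1 < 3)%N.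
pose G (u : 3.-tuple 'I_m) := F (tnth u ord0) (tnth u o1) (tnth u ord_max).
have := sum_perm_uniq_tuple G t_uniq.
rewrite card_ord !ffactnS ffactn0 muln1 => E.
rewrite [in RHS](_ : \sum_p _ = \sum_(u : 3.-tuple 'I_m | uniq u) G u) -?E //.
under eq_bigr => p _ do rewrite pair_big_dep.
rewrite pair_big_dep /=.
rewrite (reindex (fun u : 3.-tuple 'I_m =>
  (tnth u ord0, (tnth u o1, tnth u ord_max)))) /=.
  apply: eq_bigl => -[[|p [|q [|r []]]] //= pu]; rewrite !(tnth_nth p) /=.
  by rewrite !inE negb_or (eq_sym q p) (eq_sym r p) (eq_sym r q) andbT andbA.
exists (fun p => [tuple p.1; p.2.1; p.2.2]) => [|[p [q r]] _] //.
move=> [[|p [|q [|r []]]] //= pu] _.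
exact: val_inj.
Qed.

(** * Sums over sorted positions *)

Lemma sum_above (R : nmodType) m u (f : nat -> R) :
  \sum_(0 <= v < m | (u < v)%N) f v =
  \sum_(1 <= h < m | (u + h < m)%N) f (u + h)%N.
Proof.
have -> : \sum_(0 <= v < m | (u < v)%N) f v = \sum_(1 + u <= v < m) f v.
  by rewrite [RHS](big_nat_widenl _ 0).
rewrite big_addn (big_nat_widen 1 (m - u) m) ?leq_subr //=.
by apply: eq_big => h; [rewrite ltn_subRL | rewrite addnC].
Qed.

Lemma sum_shifts_below (R : nmodType) m h (x : R) :
  \sum_(0 <= u < m | (u + h < m)%N) x = x *+ (m - h).
Proof.
under eq_bigl => u do rewrite addnC -ltn_subRL.
rewrite -(big_nat_widen 0 (m - h) m xpredT) ?leq_subr //.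
by rewrite sumr_const_nat subn0.
Qed.

(** There are [m - h] pairs of positions at distance [h]. *)
Lemma sum_pairs_by_gap (R : nmodType) m (f : nat -> R) :
  \sum_(u < m) \sum_(v < m | (u < v)%N) f (v - u)%N =
  \sum_(1 <= h < m) f h *+ (m - h).
Proof.
transitivity (\sum_(0 <= u < m) \sum_(1 <= h < m | (u + h < m)%N) f h).
  rewrite big_mkord; apply: eq_bigr => u _.
  rewrite -(big_mkord (fun v => u < v)%N (fun v => f (v - u)%N)) sum_above.
  by apply: eq_bigr => h _; rewrite addKn.
rewrite (exchange_big_dep xpredT) //=.
by apply: eq_bigr => h _; rewrite sum_shifts_below.
Qed.

(** There are [m - h1 - h2] increasing triples of positions with successive
    gaps [h1] and [h2]. *)
Lemma sum_triples_by_gaps (R : nmodType) m (f : nat -> nat -> R) :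
  \sum_(u < m) \sum_(v < m | (u < v)%N) \sum_(w < m | (v < w)%N)
     f (v - u)%N (w - v)%N =
  \sum_(1 <= h1 < m) \sum_(1 <= h2 < m | (h1 + h2 <= m - 1)%N)
     f h1 h2 *+ (m - h1 - h2).
Proof.
transitivity (\sum_(0 <= u < m) \sum_(1 <= h1 < m)
    \sum_(1 <= h2 < m | (u + (h1 + h2) < m)%N) f h1 h2).
  rewrite big_mkord; apply: eq_bigr => u _.
  rewrite -(big_mkord (fun v => u < v)%N
     (fun v => \sum_(w < m | (v < w)%N) f (v - u)%N (w - v)%N)).
  rewrite sum_above big_mkcond /=.
  apply: eq_bigr => h1 _; case: ifP => [lt1|ge1].
    rewrite -(big_mkord (fun w => u + h1 < w)%N
      (fun w => f (u + h1 - u)%N (w - (u + h1))%N)) sum_above.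
    by apply: eq_big => h2 *; rewrite -?addnA // addKn addnA addKn.
  by rewrite big1 // => h2; lia.
rewrite exchange_big /=; apply: eq_big_nat => h1 /andP[h1_gt0 _].
rewrite [LHS](exchange_big_dep_nat (fun h2 => h1 + h2 <= m - 1)%N) /=;
  last by lia.
by apply: eq_bigr => h2 _; rewrite sum_shifts_below subnDA.
Qed.

Lemma sum_distinct_triples (R : nmodType) m (F : 'I_m -> 'I_m -> 'I_m -> R) :
  \sum_p \sum_(q | q != p) \sum_(r | (r != p) && (r != q)) F p q r =
  \sum_(u < m) \sum_(v < m | (u < v)%N) \sum_(w < m | (v < w)%N)
    (F u v w + F u w v + F v u w + F v w u + F w u v + F w v u).
Proof.
(* Each of the six sums is a full triple sum [T] restricted by an indicator
   [I]; renaming the summation variables brings all of them to [F p q r]. *)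
pose T (G : 'I_m -> 'I_m -> 'I_m -> R) := \sum_p \sum_q \sum_r G p q r.
have T12 G : T G = T (fun p q r => G q p r) by rewrite /T exchange_big.
have T23 G : T G = T (fun p q r => G p r q).
  by apply: eq_bigr => p _; rewrite exchange_big.
have TD G H : T (fun p q r => G p q r + H p q r) = T G + T H.
  by rewrite -big_split; apply: eq_bigr => p _; rewrite -big_split;
     apply: eq_bigr => q _; rewrite -big_split.
pose I (b : bool) (y : R) := if b then y else 0.
have -> : \sum_(u < m) \sum_(v < m | (u < v)%N) \sum_(w < m | (v < w)%N)
    (F u v w + F u w v + F v u w + F v w u + F w u v + F w v u) =
  T (fun u v w => I (u < v < w)%N (F u v w) + I (u < v < w)%N (F u w v) +
   I (u < v < w)%N (F v u w) + I (u < v < w)%N (F v w u) +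
   I (u < v < w)%N (F w u v) + I (u < v < w)%N (F w v u)).
  apply: eq_bigr => u _; rewrite big_mkcond; apply: eq_bigr => v _ /=.
  rewrite big_mkcond; case: (u < v)%N; last first.
    by rewrite big1 // => w _; rewrite !addr0.
  by apply: eq_bigr => w _; rewrite /I /=; case: ifP => _; rewrite ?addr0.
rewrite !TD.
have -> : T (fun u v w => I (u < v < w)%N (F u w v)) =
  T (fun p q r => I (p < r < q)%N (F p q r)) by rewrite T23.
have -> : T (fun u v w => I (u < v < w)%N (F v u w)) =
  T (fun p q r => I (q < p < r)%N (F p q r)) by rewrite T12.
have -> : T (fun u v w => I (u < v < w)%N (F v w u)) =
  T (fun p q r => I (r < p < q)%N (F p q r)) by rewrite T12 T23.
have -> : T (fun u v w => I (u < v < w)%N (F w u v)) =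
  T (fun p q r => I (q < r < p)%N (F p q r)) by rewrite T23 T12.
have -> : T (fun u v w => I (u < v < w)%N (F w v u)) =
  T (fun p q r => I (r < q < p)%N (F p q r)) by rewrite T23 T12 T23.
rewrite -!TD; apply: eq_bigr => p _.
rewrite big_mkcond; apply: eq_bigr => q _ /=.
rewrite big_mkcond -(inj_eq val_inj) /=.
case: ifP => [nqp|/negbFE/eqP ->].
  apply: eq_bigr => r _; rewrite -!(inj_eq val_inj) /= /I.
  by case: (ltngtP p q) nqp => // lpq _; case: (ltngtP p r) => lpr /=;
     case: (ltngtP q r) => lqr /=; rewrite ?addr0 ?add0r //; lia.
rewrite big1 // => r _; rewrite /I; case: ifP; [lia|] => _.
do !(case: ifP; [lia|] => _); by rewrite !addr0.
Qed.

(** * Moments of the design *)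

(** The value of [z_ij] when [i] stands at position [p] and [j] at position [q],
    extended antisymmetrically and by zero on the diagonal; this makes it
    meaningful for all pairs of treatments, not only for those in [S]. *)
Definition skew (R : zmodType) (c : nat -> R) (p q : nat) : R :=
  if (p < q)%N then c (q - p)%N else if (q < p)%N then - c (p - q)%N else 0.

Lemma skewC (R : zmodType) (c : nat -> R) p q : skew c q p = - skew c p q.
Proof. by rewrite /skew; case: ltngtP; rewrite ?opprK ?oppr0. Qed.

Lemma skewpp (R : zmodType) (c : nat -> R) p : skew c p p = 0.
Proof. by rewrite /skew ltnn. Qed.

Lemma skew_lt (R : zmodType) (c : nat -> R) p q :
  (p < q)%N -> skew c p q = c (q - p)%N.
Proof. by rewrite /skew => ->. Qed.

Lemma z_skew (R : realFieldType) m (c : nat -> R) (a : 'S_m) r :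
  z c a r 0 = skew c ((a^-1)%g (tnth (Spairs m) r).1)
                     ((a^-1)%g (tnth (Spairs m) r).2).
Proof.
rewrite mxE /skew /hdist /pos; have := tnth_Spairs_lt r.
case: (tnth _ r) => i j /= ltij.
have [lt|gt|/val_inj/perm_inj eij] := ltngtP.
- by rewrite distnC distnEl // ltnW.
- by rewrite distnEl // ltnW.
- by move: ltij; rewrite eij ltnn.
Qed.

(** Relabelling by a transposition permutes the orderings, so a function whose
    sign it changes has zero mean. *)
Lemma sum_perm_tperm (R : realFieldType) m (f : 'S_m -> R) (i j : 'I_m) :
  (forall a, f (tperm i j * a)%g = - f a) -> \sum_a f a = 0.
Proof.
move=> fN; have : \sum_a f a = - \sum_a f a.
  by rewrite [LHS](reindex_inj (mulgI (tperm i j))) -sumrN; apply: eq_bigr.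
by lra.
Qed.

Lemma moment1 (R : realFieldType) m (c : nat -> R) (i j : 'I_m) :
  \sum_(a : 'S_m) skew c (a i) (a j) = 0.
Proof.
apply: (sum_perm_tperm (i := i) (j := j)) => a.
by rewrite !permM tpermL tpermR skewC.
Qed.

Lemma moment2_disjoint (R : realFieldType) m (c : nat -> R) (i j k l : 'I_m) :
  i != k -> i != l -> j != k -> j != l ->
  \sum_(a : 'S_m) skew c (a i) (a j) * skew c (a k) (a l) = 0.
Proof.
move=> ik il jk jl; apply: (sum_perm_tperm (i := i) (j := j)) => a.
by rewrite !permM tpermL tpermR !tpermD // skewC mulNr.
Qed.

Lemma moment2_same (R : realFieldType) m (c : nat -> R) (i j : 'I_m) :
  (1 < m)%N -> i != j ->
  \sum_(a : 'S_m) skew c (a i) (a j) * skew c (a i) (a j) = m`!%:R * b0 m c.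
Proof.
move=> m_gt1 nij; under eq_bigr do rewrite -expr2.
have /= := sum_perm_pair (fun p q : 'I_m => skew c p q ^+ 2) nij.
set S := \sum_a _.
have -> : \sum_(p < m) \sum_(q < m | q != p) skew c p q ^+ 2 =
    2 * \sum_(1 <= h < m) (m - h)%:R * c h ^+ 2.
  transitivity (\sum_(p < m) \sum_(q < m) skew c p q ^+ 2).
    by apply: eq_bigr => p _; rewrite [RHS](bigD1 p) //= skewpp expr0n add0r.
  rewrite sum_offdiag_sym => [|p q|p]; last 2 first.
  - by rewrite skewC sqrrN.
  - by rewrite skewpp expr0n.
  rewrite [RHS]mulr_natl; congr (_ *+ _).
  under [RHS]eq_bigr => h _ do rewrite mulr_natl.
  rewrite -sum_pairs_by_gap; apply: eq_bigr => p _; apply: eq_bigr => q ltpq.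
  by rewrite skew_lt.
rewrite natrM -subn1 natrB ?(ltnW m_gt1) // => E.
have mE : m%:R != 0 :> R by rewrite pnatr_eq0; lia.
have m1E : m%:R - 1 != 0 :> R by rewrite subr_eq0 pnatr_eq1; lia.
by rewrite /b0 mulrA -E; field; rewrite mE m1E.
Qed.

(** For positions [u < v < w] with gaps [h1] and [h2], the six placements of
    [i, j, k] contribute twice
    [c h1 * c (h1 + h2)] ([i] first), [- c h1 * c h2] ([i] in the middle) and
    [c h2 * c (h1 + h2)] ([i] last).  Exchanging the gaps identifies the sums of
    the first and last terms, which gives the numerator of [b1]. *)
Lemma moment2_adjacent (R : realFieldType) m (c : nat -> R) (i j k : 'I_m) :
  (2 < m)%N -> i != j -> i != k -> j != k ->
  \sum_(a : 'S_m) skew c (a i) (a j) * skew c (a i) (a k) = m`!%:R * b1 m c.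
Proof.
move=> m_gt2 nij nik njk.
have /= :=
  sum_perm_triple (fun p q r : 'I_m => skew c p q * skew c p r) nij nik njk.
set S := \sum_a _.
have -> : \sum_(p < m) \sum_(q < m | q != p) \sum_(r < m | (r != p) && (r != q))
            skew c p q * skew c p r =
    2 * \sum_(1 <= h1 < m) \sum_(1 <= h2 < m | (h1 + h2 <= m - 1)%N)
       (m - h1 - h2)%:R * c h1 * (2 * c (h1 + h2)%N - c h2).
  rewrite sum_distinct_triples.
  pose f h1 h2 :=
    2 * (c h1 * c (h1 + h2)%N + c h2 * c (h1 + h2)%N - c h1 * c h2).
  transitivity (\sum_(u < m) \sum_(v < m | (u < v)%N) \sum_(w < m | (v < w)%N)
      f (v - u)%N (w - v)%N).
    apply: eq_bigr => u _; apply: eq_bigr => v ltuv; apply: eq_bigr => w ltvw.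
    rewrite (skewC _ u v) (skewC _ v w) (skewC _ u w) !skew_lt //;
      last exact: ltn_trans ltvw.
    rewrite /f (_ : (v - u + (w - v))%N = (w - u)%N); first by ring.
    by lia.
  rewrite sum_triples_by_gaps.
  pose D (g : nat -> nat -> R) :=
    \sum_(1 <= h1 < m) \sum_(1 <= h2 < m | (h1 + h2 <= m - 1)%N)
      (m - h1 - h2)%:R * g h1 h2.
  have DC g : D g = D (fun h1 h2 => g h2 h1).
    rewrite /D (exchange_big_dep_nat xpredT) //=; apply: eq_bigr => h2 _.
    by apply: eq_big => [h1|h1 _]; rewrite 1?addnC // -!subnDA addnC.
  have DD g h : D (fun h1 h2 => g h1 h2 + h h1 h2) = D g + D h.
    rewrite -big_split; apply: eq_bigr => h1 _; rewrite -big_split.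
    by apply: eq_bigr => h2 _; rewrite mulrDr.
  transitivity (D (fun h1 h2 =>
      (2 * c h1 * c (h1 + h2)%N - 2 * c h1 * c h2) + 2 * c h2 * c (h1 + h2)%N)).
    apply: eq_bigr => h1 _; apply: eq_bigr => h2 _.
    by rewrite /f -mulr_natl; ring.
  (* The symmetry [DC] exchanges the two gaps in the last term only. *)
  rewrite DD [X in _ + X]DC -DD mulr_sumr; apply: eq_bigr => h1 _.
  rewrite mulr_sumr; apply: eq_bigr => h2 _.
  by rewrite (addnC h2); ring.
rewrite !natrM -!subn1 -subnDA addn1.
rewrite !natrB //; [move=> E | lia..].
have mE : m%:R != 0 :> R by rewrite pnatr_eq0; lia.
have m1E : m%:R - 1 != 0 :> R by rewrite subr_eq0 pnatr_eq1; lia.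
have m2E : m%:R - 2 != 0 :> R by rewrite subr_eq0 eqr_nat; lia.
by rewrite /b1 mulrA -E; field; rewrite mE m1E m2E.
Qed.

(** The antisymmetric form of the covariance.  On pairs [i < j] and [k < l] the
    factor of [b0 - 2 b1] is the Kronecker delta of the two pairs, and that of
    [b1] is the corresponding entry of [B B^T]. *)
Lemma moment2 (R : realFieldType) m (c : nat -> R) (i j k l : 'I_m) :
  (2 < m)%N -> i != j -> k != l ->
  \sum_(a : 'S_m) skew c (a i) (a j) * skew c (a k) (a l) =
  m`!%:R *
    ((b0 m c - 2 * b1 m c) *
       ((i == k)%:R * (j == l)%:R - (i == l)%:R * (j == k)%:R)
     + b1 m c * ((i == k)%:R - (i == l)%:R - (j == k)%:R + (j == l)%:R)).
Proof.
move=> m_gt2 nij nkl; have m_gt1 := ltnW m_gt2.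
have nji := nij; rewrite eq_sym in nji.
have flip (u v s t : 'I_m) :
    \sum_(a : 'S_m) skew c (a u) (a v) * skew c (a s) (a t) =
    - \sum_(a : 'S_m) skew c (a u) (a v) * skew c (a t) (a s).
  by rewrite -sumrN; apply: eq_bigr => a _; rewrite (skewC _ (a t)) mulrN.
have flip2 (u v s t : 'I_m) :
    \sum_(a : 'S_m) skew c (a u) (a v) * skew c (a s) (a t) =
    - \sum_(a : 'S_m) skew c (a v) (a u) * skew c (a s) (a t).
  by rewrite -sumrN; apply: eq_bigr => a _; rewrite (skewC _ (a v)) mulNr.
have [eik|nik] := eqVneq i k; have [ejl|njl] := eqVneq j l.
- subst k l; rewrite (negPf nij) (negPf nji) moment2_same //=.
  by rewrite mulr1n mulr0n; ring.
- subst k; rewrite (negPf nkl) (negPf nji) moment2_adjacent //=.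
  by rewrite mulr1n mulr0n; ring.
- subst l; rewrite eq_sym in nkl; rewrite flip flip2 opprK moment2_adjacent //.
  by rewrite (negPf nij) (negPf nkl) /= mulr1n mulr0n; ring.
have [eil|nil] := eqVneq i l; have [ejk|njk] := eqVneq j k.
- by subst k l; rewrite flip moment2_same //= mulr1n mulr0n; ring.
- by subst l; rewrite flip moment2_adjacent //= mulr1n mulr0n; ring.
- by subst k; rewrite flip2 moment2_adjacent //= mulr1n mulr0n; ring.
- by rewrite moment2_disjoint //= mulr0n; ring.
Qed.

Lemma sum_block_mx (V : nmodType) m1 m2 n1 n2 (I : Type) (s : seq I)
    (A : I -> 'M[V]_(m1, n1)) (B : I -> 'M_(m1, n2))
    (C : I -> 'M_(m2, n1)) (D : I -> 'M_(m2, n2)) :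
  \sum_(i <- s) block_mx (A i) (B i) (C i) (D i) =
  block_mx (\sum_(i <- s) A i) (\sum_(i <- s) B i)
           (\sum_(i <- s) C i) (\sum_(i <- s) D i).
Proof.
elim: s => [|i s IHs]; first by rewrite !big_nil block_mx0.
by rewrite !big_cons IHs add_block_mx.
Qed.

Lemma M0_block (R : realFieldType) m (c : nat -> R) :
  (2 < m)%N ->
  M0 m c = block_mx 1%:M 0 0
    ((b0 m c - 2 * b1 m c)%:M + b1 m c *: (incidence R m *m (incidence R m)^T)).
Proof.
move=> m_gt2; have mf0 : m`!%:R != 0 :> R by rewrite pnatr_eq0 -lt0n fact_gt0.
(* The moments take [a] from treatments to positions, the design from positions
   to treatments: summing over all of ['S_m], the inverse can be dropped. *)
have mean0 : \sum_(a : 'S_m) z c a = 0.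
  apply/matrixP => r k; rewrite summxE !mxE ord1.
  under eq_bigr => a _ do rewrite z_skew.
  rewrite (reindex_inj invg_inj) /=; under eq_bigr => a _ do rewrite invgK.
  exact: moment1.
have cov : \sum_(a : 'S_m) z c a *m (z c a)^T = m`!%:R *:
    ((b0 m c - 2 * b1 m c)%:M + b1 m c *: (incidence R m *m (incidence R m)^T)).
  apply/matrixP => r s; rewrite summxE mxE [in RHS]mxE [X in _ + X]mxE.
  rewrite incidence_gram mxE -(inj_eq (@tnth_Spairs_inj m)).
  under eq_bigr => a _ do rewrite mxE big_ord1 [_^T _ _]mxE !z_skew.
  rewrite (reindex_inj invg_inj) /=; under eq_bigr => a _ do rewrite invgK.
  have := tnth_Spairs_lt r; have := tnth_Spairs_lt s.
  case: (tnth _ r) => i j; case: (tnth _ s) => k l /= ltkl ltij.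
  rewrite moment2 -?(inj_eq val_inj) ?neq_ltn ?ltkl ?ltij // xpair_eqE.
  rewrite -!(inj_eq val_inj) /= -!natrM !mulnb.
  (* [i = l] and [j = k] would contradict [i < j] and [k < l]. *)
  have -> : (i == l :> nat) && (j == k :> nat) = false by lia.
  by rewrite subr0 mulr_natr.
rewrite /M0 /x.
under eq_bigr => a _ do
  rewrite tr_col_mx mul_col_row trmx1 mul1mx mulmx1 mul1mx.
rewrite sum_block_mx -linear_sum /= mean0 trmx0 cov.
rewrite sumr_const -cardsT card_Sym card_ord.
by rewrite -scaler_nat scale_block_mx !scaler0 !scalerA mulVf // !scale1r.
Qed.

Theorem theorem2 (R : realFieldType) (m : nat) (c : nat -> R)
    (hm : (3 <= m)%N)
    (hc1 : c 1%N = 1)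
    (hc_mono : forall h : nat, (1 <= h)%N -> (h.+1 <= m - 1)%N -> c h.+1 <= c h)
    (hc_ge0 : 0 <= c (m - 1)%N) :
  M0 m c = block_mx 1%:M 0 0 (b0 m c *: 1%:M + b1 m c *: V R m) /\
  has_spectrum (M0 m c)
    [:: (1, 1%N);
        (b0 m c + (m%:R - 2) * b1 m c, (m - 1)%N);
        (b0 m c - 2 * b1 m c, ((m - 1) * (m - 2))./2)].
Proof.
have m_gt0 : (0 < m)%N := ltnW (ltnW hm).
have m_neq0 : m%:R != 0 :> R by rewrite pnatr_eq0 -lt0n.
split.
  rewrite M0_block // incidence_mul_tr; congr block_mx.
  apply/matrixP => r s; rewrite !mxE.
  by case: eqP => _ /=; rewrite ?mulr1n ?mulr0n; ring.
rewrite M0_block //.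
apply: (has_spectrum_block (s := [:: (1, 1%N)])).
  exact: has_spectrum_scalar.
rewrite -[incidence R m *m _](scalerKV m_neq0) (scalerA (b1 m c)).
have -> : b0 m c + (m%:R - 2) * b1 m c =
  b0 m c - 2 * b1 m c + b1 m c * m%:R by ring.
apply: has_spectrum_idem.
- exact: incidence_proj_idem.
- by rewrite rank_incidence_proj // subn1.
rewrite /q -(subnK hm); move: (m - 3)%N => n; lia.
Qed.
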